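(* There exists a constant $\Psi_{reg}$ such that for every $n\in\mathbb{N}$ and every regular graph $G$ with $n$ vertices (of any degree, and not necessarily connected), \[ \min\{\mathcal{K}(G),\,\mathcal{K}(\overline{G})\}\;\leq\; n\,\Psi_{reg}. \]
   Context: Graphs are finite, simple, undirected and unweighted; they are not assumed connected here. $\overline{G}$ is the complement of $G$. For a connected graph $G$ with vertex set $\{1,\dots,n\}$, $m$ edges and vertex degrees $d_1,\dots,d_n$, Kemeny's constant is $\mathcal{K}(G)=\sum_{j\neq i}\frac{d_j}{2m}\,m_{i,j}$, where $m_{i,j}$ is the expected first time at which the simple random walk on $G$ (which moves at each step to a uniformly random neighbour) started at $i$ reaches $j$; this value does not depend on the choice of $i$. (For $n=1$ the sum is empty and $\mathcal{K}(G)=0$.) If $G$ is disconnected, $\mathcal{K}(G)=\infty$ by convention. *)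

(* Defs.v *)
From HB Require Import structures.
From mathcomp Require Import all_boot all_order all_algebra.
From mathcomp Require Import all_classical all_reals all_analysis.

Set Implicit Arguments.
Unset Strict Implicit.
Unset Printing Implicit Defensive.

Import Order.TTheory GRing.Theory Num.Theory.
Local Open Scope ring_scope.

Record sgraph (V : finType) := SGraph {
  adj :> rel V;
  adj_sym : symmetric adj;
  adj_irr : irreflexive adj
}.

Section Graph.
Variables (V : finType) (G : sgraph V).

Lemma compl_sym : symmetric [rel x y | (x != y) && ~~ G x y].
Proof. by move=> x y /=; rewrite eq_sym adj_sym. Qed.

Lemma compl_irr : irreflexive [rel x y | (x != y) && ~~ G x y].
Proof. by move=> x /=; rewrite eqxx. Qed.

Definition compl : sgraph V := SGraph compl_sym compl_irr.

Definition deg (x : V) : nat := #|[set y | G x y]|.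

Definition edges : {set {set V}} :=
  [set [set p.1; p.2] | p : V * V & G p.1 p.2].

Definition regular : Prop := exists d : nat, forall x : V, deg x = d.

Definition connected_graph : bool := [forall x, forall y, connect G x y].

End Graph.

Section Kemeny.
Variables (R : realType) (V : finType) (G : sgraph V).

Definition step (x y : V) : R := (G x y)%:R / (deg G x)%:R.

(* Probability that the walk started at [x] has the successive positions [s]
   at times 1, ..., size s. *)
Fixpoint walk_prob (x : V) (s : seq V) : R :=
  if s is y :: s' then step x y * walk_prob y s' else 1.

(* P(T = t), where T is the first time (time 0 included) at which the walk
   started at [x] is at [y]: the trajectory x :: w is at [y] at time t, and at
   none of the times 0, ..., t - 1. *)
Definition hit_prob (x y : V) (t : nat) : R :=
  \sum_(w : t.-tuple V | (last x w == y) && (y \notin belast x w))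
    walk_prob x w.

(* E[T] for T with values in {0, 1, ..., +oo}; the second summand is
   +oo * P(T = +oo), with +oo * 0 = 0. *)
Definition hitting_time (x y : V) : \bar R :=
  (\sum_(0 <= t <oo) (t%:R * hit_prob x y t)%:E
   + +oo * (1 - \sum_(0 <= t <oo) (hit_prob x y t)%:E))%E.

Definition kemeny_from (x : V) : \bar R :=
  (\sum_(y | y != x)
     ((deg G y)%:R / (2 * #|edges G|)%:R)%:E * hitting_time x y)%E.

(* For a connected graph [kemeny_from x] does not depend on [x], so the vertex
   selected by [pick] is immaterial. The value for the graph without vertices
   is a convention. *)
Definition kemeny : \bar R :=
  if connected_graph G then
    if [pick x : V] is Some x then kemeny_from x else 0%E
  else +oo%E.

End Kemeny.

(* Main.v *)
Require Import Defs.
From mathcomp Require Import all_boot all_order all_algebra.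
From mathcomp Require Import all_classical all_reals all_analysis.
From mathcomp Require Import ring lra.

(** Let G be d-regular on n vertices with adjacency matrix A, and P = A/d.

    Kemeny's constant of a connected G is the sum of d / (d - mu) over the
    nontrivial eigenvalues mu of A. If these are all at most 3d/4, each term is
    at most 4 and Kemeny's constant is at most 4n. The nontrivial eigenvalues of
    the complement, whose degree is n - 1 - d, are the numbers -1 - mu; so both
    bounds can fail only if A has a nontrivial eigenvalue above 3d/4 and another
    one below -3(n-d)/4. But the squares of the nontrivial eigenvalues of A add
    up to tr A^2 - d^2 = d(n-d), and
      (9/16) (d^2 + (n-d)^2) > d(n-d).
    Hence G or its complement satisfies the bound, with Psi = 4. (Any
    c < 1 with c^2 > 1/2 could replace 3/4, giving Psi = 1 / (1 - c).)

    No matrix is diagonalized here. Spectral bounds are inequalities between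
    quadratic forms on the functions of sum zero ([gap]), and the alternative
    [gap_or_gap_compl] is a Cauchy-Schwarz inequality for the Frobenius product.
    The eigenvalue formula for Kemeny's constant is replaced by a trace: the
    matrix I - P + J/n, where J is the all-ones matrix, is bounded below by 1/4
    when the gap holds, so it has an inverse Z with diagonal entries at most 4;
    the functions n (Z_yy - Z_xy) solve the first-step equations for the
    expected hitting time of y from x, and averaging them over y gives
    tr Z - 1 <= 4n ([gap_kemeny]).

    The hitting times are defined by summing over trajectories. Only an upper
    bound is needed, and [hitting_time_le] provides it: they are at most any
    nonnegative supersolution of the first-step equations. *)

Import Order.TTheory GRing.Theory Num.Theory.
Local Open Scope ring_scope.

Set Implicit Arguments.
Unset Strict Implicit.
Unset Printing Implicit Defensive.

(** * Hitting times *)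

Section HittingTimes.
Variables (R : realType) (V : finType) (G : sgraph V).
Implicit Types x y z : V.

Lemma step_ge0 x y : 0 <= step R G x y.
Proof. by apply: divr_ge0; apply: ler0n. Qed.

Lemma degE x : (deg G x)%:R = \sum_y (G x y)%:R :> R.
Proof. 
rewrite /deg -sum1_card natr_sum big_mkcond.
by apply: eq_bigr => y _; rewrite inE; case: (G x y).
Qed.

Lemma sum_step x : (0 < deg G x)%N -> \sum_y step R G x y = 1.
Proof.
by move=> d0; rewrite /step -mulr_suml -degE divff // pnatr_eq0 -lt0n.
Qed.

Lemma walk_prob_ge0 x (s : seq V) : 0 <= walk_prob R G x s.
Proof. by elim: s x => //= y s IHs x; rewrite mulr_ge0 ?step_ge0. Qed.

Lemma hit_prob_ge0 x y t : 0 <= hit_prob R G x y t.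
Proof. by apply: sumr_ge0 => w _; apply: walk_prob_ge0. Qed.

Lemma hit_prob0 x y : hit_prob R G x y 0 = (x == y)%:R.
Proof.
rewrite /hit_prob; case: eqVneq => [->|xy].
  rewrite (big_pred1 [tuple]) // => w.
  by rewrite [w]tuple0 /= !eqxx.
rewrite big_pred0 // => w.
by rewrite [w]tuple0 /= (negPf xy).
Qed.

Lemma hit_probSxx y t : hit_prob R G y y t.+1 = 0.
Proof.
apply: big1 => w; case/tupleP: w => z w /=.
by rewrite in_cons eqxx andbF.
Qed.

(** Conditioning on the first step of the walk. *)
Lemma hit_probS x y t : x != y ->
  hit_prob R G x y t.+1 = \sum_z step R G x z * hit_prob R G z y t.
Proof.
move=> xy; rewrite /hit_prob.
under [RHS]eq_bigr do rewrite mulr_sumr.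
rewrite pair_big_dep /=.
rewrite (reindex (fun p : V * t.-tuple V => [tuple of p.1 :: p.2])) /=;
  last first.
  exists (fun w : t.+1.-tuple V => (thead w, [tuple of behead w]))
      => [[z w]|w] _ /=.
    by congr pair; apply: val_inj.
  by rewrite -tuple_eta.
by apply: eq_bigl => -[z w] /=; rewrite in_cons negb_or [y == x]eq_sym xy.
Qed.

(** A truncation of the expected hitting time: with T the first time at which
    the walk from x is at y, this is E[min(T, N)]. *)
Definition trunc_hit x y N : R :=
  \sum_(t < N) t%:R * hit_prob R G x y t
    + N%:R * (1 - \sum_(t < N) hit_prob R G x y t).

Lemma trunc_hitSxx y N : trunc_hit y y N.+1 = 0.
Proof.
rewrite /trunc_hit !big_ord_recl hit_prob0 eqxx mul0r add0r.
rewrite !big1 ?addr0 ?subrr ?mulr0 ?addr0 // => i _.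
  exact: hit_probSxx.
by rewrite hit_probSxx mulr0.
Qed.

Hypothesis deg_gt0 : forall x, (0 < deg G x)%N.

Lemma sum_hit_probS x y N : x != y ->
  \sum_(t < N.+1) hit_prob R G x y t
    = \sum_z step R G x z * \sum_(t < N) hit_prob R G z y t.
Proof.
move=> xy; rewrite big_ord_recl hit_prob0 (negPf xy) add0r.
under eq_bigr do rewrite hit_probS //.
by rewrite exchange_big; apply: eq_bigr => z _; rewrite mulr_sumr.
Qed.

Lemma trunc_hitS x y N : x != y ->
  trunc_hit x y N.+1 = 1 + \sum_z step R G x z * trunc_hit z y N.
Proof.
move=> xy.
have first : \sum_(t < N.+1) t%:R * hit_prob R G x y t =
    \sum_z step R G x z * (\sum_(t < N) t%:R * hit_prob R G z y t
                            + \sum_(t < N) hit_prob R G z y t).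
  rewrite big_ord_recl mul0r add0r.
  under [RHS]eq_bigr do rewrite -big_split mulr_sumr.
  rewrite exchange_big; apply: eq_bigr => t _ /=.
  rewrite /bump /= add1n hit_probS // mulr_sumr; apply: eq_bigr => z _.
  by rewrite -natr1; ring.
have second : 1 - \sum_(t < N.+1) hit_prob R G x y t =
    \sum_z step R G x z * (1 - \sum_(t < N) hit_prob R G z y t).
  rewrite sum_hit_probS // -{1}(sum_step (deg_gt0 x)) -sumrB.
  by apply: eq_bigr => z _; ring.
rewrite /trunc_hit first second.
rewrite -[X in _ = X + _](sum_step (deg_gt0 x)) mulr_sumr.
rewrite -!big_split; apply: eq_bigr => z _ /=.
by rewrite -natr1; ring.
Qed.

Lemma sum_hit_prob_le1 x y N : \sum_(t < N) hit_prob R G x y t <= 1.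
Proof.
elim: N x => [|N IHN] x; first by rewrite big_ord0.
have [<-|xy] := eqVneq x y.
  rewrite big_ord_recl hit_prob0 eqxx big1 ?addr0 // => i _.
  exact: hit_probSxx.
rewrite sum_hit_probS // -(sum_step (deg_gt0 x)) ler_sum // => z _.
by rewrite ler_piMr ?step_ge0.
Qed.

(** Minimum principle: at a minimum other than y the value would be at least 1
    more than an average of values that are no smaller. *)
Lemma supersolution_ge0 y (H : V -> R) :
    0 <= H y ->
    (forall x, x != y -> 1 + \sum_z step R G x z * H z <= H x) ->
  forall x, 0 <= H x.
Proof.
move=> Hy HS x; have [x0 _ minH] := arg_minP H (isT : predT x).
apply: le_trans (minH x isT); have [->//|x0y] := eqVneq x0 y.
have avg : H x0 <= \sum_z step R G x0 z * H z.
  rewrite -[leLHS]mul1r -(sum_step (deg_gt0 x0)) mulr_suml.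
  by apply: ler_sum => z _; rewrite ler_wpM2l ?step_ge0 ?minH.
by have := HS x0 x0y; lra.
Qed.

(** Any nonnegative supersolution of the first-step equations dominates the
    expected hitting times: it dominates E[min(T, N)] by induction on N, and in
    particular N P(T >= N) is bounded, so that T is almost surely finite. *)
Lemma hitting_time_le y (H : V -> R) :
    (forall x, 0 <= H x) ->
    (forall x, x != y -> 1 + \sum_z step R G x z * H z <= H x) ->
  forall x, (hitting_time R G x y <= (H x)%:E)%E.
Proof.
move=> H0 HS x.
have truncle N z : trunc_hit z y N <= H z.
  elim: N z => [|N IHN] z.
    by rewrite /trunc_hit big_ord0 mul0r addr0 H0.
  have [->|zy] := eqVneq z y; first by rewrite trunc_hitSxx H0.
  rewrite trunc_hitS //; apply: le_trans (HS z zy).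
  by rewrite lerD2l ler_sum // => u _; rewrite ler_wpM2l ?step_ge0.
have tail0 N : 0 <= N%:R * (1 - \sum_(t < N) hit_prob R G x y t).
  by rewrite mulr_ge0 // subr_ge0 sum_hit_prob_le1.
have body0 N : 0 <= \sum_(t < N) t%:R * hit_prob R G x y t.
  by rewrite sumr_ge0 // => t _; rewrite mulr_ge0 ?hit_prob_ge0.
have series_le (u : nat -> R) (b : R) : (forall t, 0 <= u t) ->
    (forall N, \sum_(t < N) u t <= b) ->
    (\sum_(0 <= t <oo) (u t)%:E <= b%:E)%E.
  move=> u0 ub; apply: lime_le.
    by apply: is_cvg_nneseries => t _ _; rewrite lee_fin.
  by apply: nearW => N; rewrite sumEFin lee_fin big_mkord.
have total : (\sum_(0 <= t <oo) (hit_prob R G x y t)%:E = 1)%E.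
  have le1 := series_le _ 1 (hit_prob_ge0 x y) (sum_hit_prob_le1 x y).
  have partial N : ((\sum_(t < N) hit_prob R G x y t)%:E <=
      \sum_(0 <= t <oo) (hit_prob R G x y t)%:E)%E.
    rewrite -(big_mkord xpredT (hit_prob R G x y)) -sumEFin.
    by apply: nneseries_lim_ge => t _ _; rewrite lee_fin hit_prob_ge0.
  move: le1 partial; case: (\sum_(0 <= t <oo) _)%E => [r| |] //; last first.
    by move=> _ /(_ 0%N); rewrite leeNy_eq.
  rewrite lee_fin => le1 partial; congr EFin; apply/eqP.
  rewrite eq_le le1 /= leNgt; apply/negP => r1.
  have e0 : 0 < 1 - r by rewrite subr_gt0.
  (* If the walk misses y with probability 1 - r > 0, then E[min(T, N)] is at
     least N (1 - r), which exceeds the bound H x for this N. *)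
  pose N := (Num.truncn (H x / (1 - r))).+1.
  have : H x / (1 - r) < N%:R by apply: truncnS_gt.
  rewrite ltr_pdivrMr // ltNge => /negP; apply.
  apply: le_trans (truncle N x).
  apply: le_trans (_ : N%:R * (1 - \sum_(t < N) hit_prob R G x y t) <= _).
    by rewrite ler_wpM2l // lerB //; have := partial N; rewrite lee_fin.
  by rewrite /trunc_hit lerDr.
rewrite /hitting_time total subee // mule0 adde0.
apply: series_le => [t|N]; first by rewrite mulr_ge0 ?hit_prob_ge0.
by apply: le_trans (truncle N x); rewrite /trunc_hit lerDl.
Qed.

End HittingTimes.

(** * Coercive matrices *)

Section PositiveDefinite.
Variables (R : realType) (V : finType).

Definition sqnorm (f : V -> R) : R := \sum_x f x ^+ 2.

Lemma sqnorm_ge0 f : 0 <= sqnorm f.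
Proof. by apply: sumr_ge0 => x _; apply: sqr_ge0. Qed.

Lemma sqnorm_eq0 f : sqnorm f = 0 -> forall x, f x = 0.
Proof.
move=> f0 x; apply/eqP; rewrite -sqrf_eq0; apply/eqP.
by apply: (psumr_eq0P _ f0) => // z _; apply: sqr_ge0.
Qed.

(** A function f with f K = 0 pairs to zero with K f, so that coercivity makes
    the matrix K injective, hence invertible. *)
Lemma coercive_inverse (K : V -> V -> R) (c : R) : 0 < c ->
    (forall f : V -> R,
       c * sqnorm f <= \sum_x \sum_y K x y * f x * f y) ->
  exists Z : V -> V -> R,
    (forall x y, \sum_z K x z * Z z y = (x == y)%:R) /\
    (forall x y, \sum_z Z x z * K z y = (x == y)%:R).
Proof.
move=> c0 coercive.
pose M := \matrix_(i < #|V|, j < #|V|) K (enum_val i) (enum_val j).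
have sum_enum (F : V -> R) : \sum_x F x = \sum_(i < #|V|) F (enum_val i).
  by rewrite -(@big_enum_val _ _ _ _ predT).
have unitM : M \in unitmx.
  rewrite -row_free_unit; apply: inj_row_free => v vM0.
  pose f x := v 0 (enum_rank x).
  have fval i : f (enum_val i) = v 0 i by rewrite /f enum_valK.
  have : \sum_x \sum_y K x y * f x * f y = 0.
    rewrite exchange_big big1 //= => y _; rewrite -mulr_suml.
    suff -> : \sum_x K x y * f x = 0 by rewrite mul0r.
    have /matrixP/(_ 0 (enum_rank y)) := vM0.
    rewrite !mxE => colE; rewrite sum_enum -[RHS]colE.
    apply: eq_bigr => i _.
    by rewrite mxE enum_rankK fval mulrC.
  move=> K0; have := coercive f; rewrite K0 pmulr_rle0 // => le0.
  have f0 : sqnorm f = 0 by apply/eqP; rewrite eq_le le0 sqnorm_ge0.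
  by apply/rowP => i; rewrite mxE -fval sqnorm_eq0.
exists (fun x y => invmx M (enum_rank x) (enum_rank y)); split=> x y.
  have /matrixP/(_ (enum_rank x) (enum_rank y)) := mulmxV unitM.
  rewrite !mxE (inj_eq enum_rank_inj) => <-; rewrite sum_enum.
  apply: eq_bigr => i _.
  by rewrite mxE enum_rankK enum_valK.
have /matrixP/(_ (enum_rank x) (enum_rank y)) := mulVmx unitM.
rewrite !mxE (inj_eq enum_rank_inj) => <-; rewrite sum_enum.
apply: eq_bigr => i _.
by rewrite mxE enum_rankK enum_valK.
Qed.

End PositiveDefinite.

(** * The spectral alternative *)

Section SpectralGap.
Variables (R : realType) (V : finType).
Implicit Types (G : sgraph V) (f g : V -> R) (x y z : V).

Definition adj_form G f : R := \sum_x \sum_y (G x y)%:R * f x * f y.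

(** For a d-regular graph: every eigenvalue of the adjacency matrix other than
    the trivial eigenvalue d is at most 3d/4. The Rayleigh quotient version
    dispenses with diagonalization. *)
Definition gap G (d : R) : Prop :=
  forall f, \sum_x f x = 0 -> adj_form G f <= 3 / 4 * d * sqnorm f.

Lemma adj_form0 G f : (forall x, f x = 0) -> adj_form G f = 0.
Proof.
move=> f0; apply: big1 => x _; apply: big1 => y _.
by rewrite f0 mulr0 mul0r.
Qed.

Lemma adj_form_deg0 G f : (forall x, deg G x = 0%N) -> adj_form G f = 0.
Proof.
move=> G0; apply: big1 => x _; apply: big1 => y _.
have /eqP := G0 x; rewrite cards_eq0 => /eqP/setP/(_ y).
by rewrite !inE => ->; rewrite !mul0r.
Qed.

(** The two adjacency matrices add up to J - I, and J vanishes on the functions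
    of sum zero. *)
Lemma adj_form_compl G f : \sum_x f x = 0 ->
  adj_form (compl G) f = - sqnorm f - adj_form G f.
Proof.
move=> f0; apply/eqP; rewrite eq_sym subr_eq -big_split /=; apply/eqP.
rewrite -sumrN; apply: eq_bigr => x _; rewrite -big_split /=.
transitivity (\sum_y (f x * f y - (x == y)%:R * f x * f y)).
  rewrite sumrB -mulr_sumr f0 mulr0 sub0r (bigD1 x) //= eqxx big1 ?addr0.
    by rewrite mul1r expr2.
  by move=> y yx; rewrite eq_sym (negPf yx) !mul0r.
apply: eq_bigr => y _ /=; have [<-|xy] /= := eqVneq x y.
  by rewrite adj_irr /=; ring.
by case: (G x y) => /=; ring.
Qed.

Lemma deg_compl G x : (deg (compl G) x + deg G x).+1 = #|V|.
Proof.
rewrite -(cardsC [set y | G x y]) /deg addnC -addnS; congr (_ + _)%N.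
rewrite (cardsD1 x (~: _)) !inE adj_irr add1n; congr _.+1.
by apply: eq_card => y; rewrite !inE /= [y == x]eq_sym.
Qed.

Lemma sum_adj G d x : (forall x, deg G x = d) ->
  \sum_y (G x y)%:R = d%:R :> R.
Proof. by move=> Gd; rewrite -degE Gd. Qed.

(** If A and its complement both failed, A would have two eigenvalues, one
    above 3d/4 and one below -3(n-d)/4, besides the trivial one, whereas the
    squares of the nontrivial eigenvalues add up to tr A^2 - d^2 = d(n-d), which
    is at most (d^2 + (n-d)^2)/2. For functions f and g with such Rayleigh
    quotients, the trace argument becomes the Cauchy-Schwarz inequality for the
    Frobenius product of the matrices A - (d/n)J and
    d f f^T / |f|^2 - (n-d) g g^T / |g|^2. *)
Lemma gap_or_gap_compl G d : (forall x, deg G x = d) -> (0 < d)%N ->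
  gap G d%:R \/ gap (compl G) (#|V| - d.+1)%:R.
Proof.
move=> Gd d0.
have [|nogap] := pselect (gap G d%:R); [by left | right=> g g0].
move: nogap => /existsNP[f /not_implyP[f0 /negP]].
rewrite -ltNge => Qf; rewrite leNgt; apply/negP => Qg.
have V0 : (d < #|V|)%N.
  have [x|V0] := pickP V; first by rewrite -(deg_compl G x) Gd ltnS leq_addl.
  by move: Qf; rewrite /sqnorm /adj_form !big_pred0 ?mulr0 ?ltxx.
set a : R := d%:R in Qf *; pose n : R := #|V|%:R; pose b := n - a.
have a0 : 0 < a by rewrite ltr0n.
have n0 : 0 < n by rewrite ltr0n; apply: leq_trans V0.
have b1 : 1 <= b by rewrite /b lerBrDl /a natr1 ler_nat.
rewrite natrB // -natr1 -/n -/a (adj_form_compl _ g0) in Qg.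
have p0 : 0 < sqnorm f.
  rewrite lt_neqAle sqnorm_ge0 andbT; apply/eqP => f00.
  by move: Qf; rewrite -f00 adj_form0 ?mulr0 ?ltxx //; apply: sqnorm_eq0.
have q0 : 0 < sqnorm g.
  rewrite lt_neqAle sqnorm_ge0 andbT; apply/eqP => g00.
  move: Qg; rewrite -g00 adj_form0 ?mulr0 ?subr0 ?oppr0 ?ltxx //.
  exact: sqnorm_eq0.
set p := sqnorm f in Qf p0; set q := sqnorm g in Qg q0.
have Qfp : 3 / 4 * a < adj_form G f / p by rewrite ltr_pdivlMr.
have Qgq : adj_form G g / q < - (3 / 4) * b.
  rewrite ltr_pdivrMr // /b; nra.
pose X x y := a / p * (f x * f y) - b / q * (g x * g y).
pose B x y := (G x y)%:R - a / n.
have sumJ (h : V -> R) : \sum_x h x = 0 -> \sum_x \sum_y h x * h y = 0.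
  by move=> h0; rewrite big1 // => x _; rewrite -mulr_sumr h0 mulr0.
have sumsq (h : V -> R) : \sum_x \sum_y (h x * h y) ^+ 2 = sqnorm h ^+ 2.
  rewrite expr2 mulr_suml; apply: eq_bigr => x _.
  by rewrite mulr_sumr; apply: eq_bigr => y _; rewrite exprMn.
have sumfg : \sum_x \sum_y (f x * f y) * (g x * g y) = (\sum_x f x * g x) ^+ 2.
  rewrite expr2 mulr_suml; apply: eq_bigr => x _.
  by rewrite mulr_sumr; apply: eq_bigr => y _; ring.
have XX : \sum_x \sum_y X x y ^+ 2 <= a ^+ 2 + b ^+ 2.
  have -> : \sum_x \sum_y X x y ^+ 2 =
      (a / p) ^+ 2 * \sum_x \sum_y (f x * f y) ^+ 2
    + (b / q) ^+ 2 * \sum_x \sum_y (g x * g y) ^+ 2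
    - 2 * (a / p) * (b / q) * \sum_x \sum_y (f x * f y) * (g x * g y).
    rewrite !mulr_sumr -big_split -sumrB; apply: eq_bigr => x _ /=.
    rewrite !mulr_sumr -big_split -sumrB; apply: eq_bigr => y _ /=.
    by rewrite /X; ring.
  rewrite !sumsq sumfg -/p -/q -!exprMn !divfK ?gt_eqF // lerBlDr lerDl.
  have b0 := lt_le_trans ltr01 b1.
  have ap0 : 0 <= a / p by rewrite divr_ge0 // ltW.
  have bq0 : 0 <= b / q by rewrite divr_ge0 // ltW.
  by rewrite (mulr_ge0 _ (sqr_ge0 _)) // (mulr_ge0 (mulr_ge0 _ ap0) bq0).
have BB : \sum_x \sum_y B x y ^+ 2 = a * b.
  have -> : \sum_x \sum_y B x y ^+ 2 = \sum_(x : V) (a * b / n).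
    apply: eq_bigr => x _.
    under eq_bigr => y _ do have -> : B x y ^+ 2 =
      (1 - 2 * (a / n)) * (G x y)%:R + (a / n) ^+ 2
      by rewrite /B; case: (G x y) => /=; ring.
    rewrite big_split -mulr_sumr (sum_adj (d := d)) //.
    rewrite sumr_const /= -[_ *+ #|_|]mulr_natl.
    by rewrite -/n -/a /b; field; rewrite gt_eqF //.
  by rewrite sumr_const -mulr_natl -/n mulrC divfK // gt_eqF.
have BX : \sum_x \sum_y B x y * X x y =
    a * (adj_form G f / p) - b * (adj_form G g / q).
  have -> : \sum_x \sum_y B x y * X x y =
      a / p * adj_form G f - b / q * adj_form G g
    - a / n * (a / p) * \sum_x \sum_y f x * f y
    + a / n * (b / q) * \sum_x \sum_y g x * g y.
    rewrite /adj_form !mulr_sumr -!sumrB -big_split; apply: eq_bigr => x _ /=.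
    rewrite !mulr_sumr -!sumrB -big_split; apply: eq_bigr => y _ /=.
    by rewrite /X /B; ring.
  by rewrite !sumJ // !mulr0 subr0 addr0; ring.
(* Cauchy-Schwarz, as the nonnegativity of |B - t X|^2. With W = a^2 + b^2, the
   bounds are |X|^2 <= W and <B, X> > (3/4) W, and t = 3/4 minimizes
   t^2 W - 2 t (3/4) W. *)
have : 0 <= \sum_x \sum_y (B x y - 3 / 4 * X x y) ^+ 2.
  by do 2!(apply: sumr_ge0 => ? _); apply: sqr_ge0.
have -> : \sum_x \sum_y (B x y - 3 / 4 * X x y) ^+ 2 =
    \sum_x \sum_y B x y ^+ 2 - 3 / 2 * \sum_x \sum_y B x y * X x y
    + 9 / 16 * \sum_x \sum_y X x y ^+ 2.
  rewrite !mulr_sumr -!sumrB -big_split; apply: eq_bigr => x _ /=.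
  rewrite !mulr_sumr -!sumrB -big_split; apply: eq_bigr => y _ /=.
  by field.
rewrite BB BX leNgt => /negP; apply.
have aQ : 3 / 4 * a ^+ 2 < a * (adj_form G f / p) by nra.
have bQ : 3 / 4 * b ^+ 2 < - (b * (adj_form G g / q)) by nra.
have := sqr_ge0 (a - b).
nra.
Qed.

End SpectralGap.

(** * From the gap to Kemeny's constant *)

Section EdgeCount.
Variables (V : finType) (G : sgraph V).

(** Each edge is the image of at most two ordered pairs of adjacent vertices. *)
Lemma sum_deg_le : (\sum_x deg G x <= 2 * #|edges G|)%N.
Proof.
have -> : (\sum_x deg G x = \sum_(p in [set p : V * V | G p.1 p.2]) 1)%N.
  under eq_bigr do rewrite /deg -sum1dep_card.
  by rewrite pair_big_dep; apply: eq_bigl => -[x y]; rewrite inE.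
rewrite (partition_big_imset (fun p : V * V => [set p.1; p.2])) /= -/(edges G).
rewrite mulnC -sum_nat_const; apply: leq_sum => e /imsetP[[x y] _ ->] /=.
rewrite sum1dep_card.
apply: leq_trans (_ : #|[set (x, y); (y, x)]| <= 2)%N; last first.
  by rewrite cards2; case: (_ != _).
apply: subset_leq_card; apply/fintype.subsetP => -[u v].
rewrite !inE /= => /andP[uv /eqP/setP E]; move: uv (E u) (E v).
rewrite !inE !eqxx ?orbT => uv.
move=> /esym/orP[]/eqP u_eq /esym/orP[]/eqP v_eq; move: uv.
all: by rewrite u_eq v_eq ?adj_irr ?eqxx ?orbT.
Qed.

End EdgeCount.

Section GapKemeny.
Variables (R : realType) (V : finType) (G : sgraph V) (d : nat).
Implicit Types (f g : V -> R) (x y z : V).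
Hypothesis Gd : forall x, deg G x = d.
Hypothesis d_gt0 : (0 < d)%N.
Hypothesis Ggap : gap G (d%:R : R).

Let n : R := #|V|%:R.

(** If u is the indicator of a component, its centered version f satisfies
    A f = d f: a second eigenvalue d, which the gap excludes unless f = 0. *)
Lemma gap_connected : connected_graph G.
Proof.
apply/forallP => x; apply/forallP => y.
pose u z : R := (connect G x z)%:R.
pose m := (\sum_z u z) / n; pose f z := u z - m.
have n0 : n != 0 by rewrite pnatr_eq0 -lt0n; apply/card_gt0P; exists x.
have f0 : \sum_z f z = 0.
  by rewrite sumrB sumr_const -mulr_natr divfK // subrr.
have fadj z w : G z w -> f w = f z.
  move=> zw; congr ((nat_of_bool _)%:R - _); apply/idP/idP => [xw|xz].
    by apply: connect_trans xw _; apply: connect1; rewrite adj_sym.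
  by apply: connect_trans xz _; apply: connect1.
have Qf : adj_form G f = d%:R * sqnorm f.
  rewrite mulr_sumr; apply: eq_bigr => z _.
  rewrite -(sum_adj _ z Gd) mulr_suml; apply: eq_bigr => w _.
  by case: (boolP (G z w)) => [/fadj->|_]; rewrite ?mul0r // !mul1r expr2.
have /sqnorm_eq0 fz : sqnorm f = 0.
  have := Ggap f0; rewrite Qf; have := sqnorm_ge0 f.
  have : 0 < d%:R :> R by rewrite ltr0n.
  nra.
have : u y = u x.
  by have := fz x; have := fz y; rewrite /f; lra.
rewrite /u connect0; case: (connect G x y) => // /eqP.
by rewrite eq_sym oner_eq0.
Qed.

Lemma adj_form_shift g (m : R) : \sum_x g x = 0 ->
  adj_form G (fun x => g x + m) = adj_form G g + m ^+ 2 * d%:R * n.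
Proof.
move=> g0.
have row x : \sum_y (G x y)%:R = d%:R :> R by apply: sum_adj.
have -> : adj_form G (fun x => g x + m) = adj_form G g
    + m * \sum_x \sum_y (G x y)%:R * g x + m * \sum_x \sum_y (G x y)%:R * g y
    + m ^+ 2 * \sum_x \sum_y (G x y)%:R.
  rewrite /adj_form !mulr_sumr -!big_split; apply: eq_bigr => x _ /=.
  rewrite !mulr_sumr -!big_split; apply: eq_bigr => y _ /=.
  by ring.
have gA0 : \sum_x \sum_y (G x y)%:R * g x = 0.
  under eq_bigr do rewrite -mulr_suml row.
  by rewrite -mulr_sumr g0 mulr0.
have -> : \sum_x \sum_y (G x y)%:R * g y = 0.
  rewrite exchange_big -[RHS]gA0; apply: eq_bigr => x _; apply: eq_bigr => y _.
  by rewrite adj_sym.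
rewrite gA0 (eq_bigr (fun=> d%:R)) // sumr_const -[_ *+ #|_|]mulr_natr -/n.
by ring.
Qed.

(** The fundamental matrix of the walk is the inverse of this matrix
    I - P + J/n, in which J/n replaces the eigenvalue 0 of I - P by 1. *)
Definition fund_kernel x y : R := (x == y)%:R - step R G x y + n^-1.

Lemma fund_kernel_coercive f :
  1 / 4 * sqnorm f <= \sum_x \sum_y fund_kernel x y * f x * f y.
Proof.
have [x0|V0] := pickP V; last by rewrite /sqnorm !big_pred0 ?mulr0.
have n0 : 0 < n by rewrite ltr0n; apply/card_gt0P; exists x0.
have d0 : 0 < d%:R :> R by rewrite ltr0n.
pose m := (\sum_x f x) / n; pose g x := f x - m.
have g0 : \sum_x g x = 0.
  by rewrite sumrB sumr_const -mulr_natr divfK ?subrr // gt_eqF.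
have Qf : adj_form G f = adj_form G g + m ^+ 2 * d%:R * n.
  rewrite -adj_form_shift //; apply: eq_bigr => x _; apply: eq_bigr => y _.
  by rewrite /g !subrK.
have sf : sqnorm f = sqnorm g + n * m ^+ 2.
  have -> : sqnorm f = sqnorm g + 2 * m * \sum_x g x + \sum_(x : V) m ^+ 2.
    rewrite mulr_sumr -!big_split; apply: eq_bigr => x _ /=.
    by rewrite /g; ring.
  by rewrite g0 mulr0 addr0 sumr_const -[_ *+ #|_|]mulr_natl.
have -> : \sum_x \sum_y fund_kernel x y * f x * f y =
    sqnorm f - adj_form G f / d%:R + n * m ^+ 2.
  have -> : n * m ^+ 2 = n^-1 * \sum_x \sum_y f x * f y.
    have -> : \sum_x \sum_y f x * f y = (\sum_x f x) ^+ 2.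
      by rewrite expr2 mulr_suml; apply: eq_bigr => x _; rewrite mulr_sumr.
    by rewrite /m; field; rewrite gt_eqF.
  have -> : sqnorm f = \sum_x \sum_y (x == y)%:R * f x * f y.
    apply: eq_bigr => x _; rewrite (bigD1 x) //= eqxx big1 ?addr0.
      by rewrite mul1r expr2.
    by move=> y yx; rewrite eq_sym (negPf yx) !mul0r.
  rewrite /adj_form mulr_suml mulr_sumr -sumrB -big_split.
  apply: eq_bigr => x _ /=; rewrite mulr_suml mulr_sumr -sumrB -big_split.
  by apply: eq_bigr => y _ /=; rewrite /fund_kernel /step Gd; ring.
have Qg : adj_form G g / d%:R <= 3 / 4 * sqnorm g.
  by rewrite ler_pdivrMr // mulrAC; apply: Ggap.
have -> : adj_form G f / d%:R = adj_form G g / d%:R + n * m ^+ 2.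
  by rewrite Qf; field; rewrite gt_eqF.
rewrite sf; have : 0 <= n * m ^+ 2 by rewrite mulr_ge0 ?sqr_ge0 // ltW.
lra.
Qed.

Lemma step_sym x y : step R G x y = step R G y x.
Proof. by rewrite /step !Gd adj_sym. Qed.

Lemma fund_kernel_sym x y : fund_kernel x y = fund_kernel y x.
Proof. by rewrite /fund_kernel eq_sym step_sym. Qed.

Lemma sum_fund_kernel x : \sum_y fund_kernel x y = 1.
Proof.
have n0 : n != 0 by rewrite pnatr_eq0 -lt0n; apply/card_gt0P; exists x.
rewrite big_split sumrB sum_step ?Gd // sumr_const -mulr_natr mulVf //=.
rewrite (bigD1 x) //= eqxx big1 ?addr0 ?subrr ?add0r // => y yx.
by rewrite eq_sym (negPf yx).
Qed.

(** Writing Z for the fundamental matrix, the expected hitting times are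
    n (Z_yy - Z_xy). As the rows of Z sum to 1, Kemeny's constant is tr Z - 1,
    and coercivity with constant 1/4 bounds each diagonal entry of Z by 4. *)
Lemma gap_kemeny : (kemeny R G <= (n * 4)%:E)%E.
Proof.
rewrite /kemeny gap_connected; case: pickP => [x _|_]; last first.
  by rewrite lee_fin mulr_ge0.
have n0 : 0 < n by rewrite ltr0n; apply/card_gt0P; exists x.
have deg0 z : (0 < deg G z)%N by rewrite Gd.
have c0 : 0 < 1 / 4 :> R by lra.
have [Z [KZ ZK]] := coercive_inverse c0 fund_kernel_coercive.
have sum_delta (y : V) : \sum_z (z == y)%:R = 1 :> R.
  by rewrite (bigD1 y) //= eqxx big1 ?addr0 // => z /negPf ->.
have Zrow z : \sum_y Z z y = 1.
  transitivity (\sum_y \sum_w Z z w * fund_kernel w y).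
    rewrite exchange_big; apply: eq_bigr => w _ /=.
    by rewrite -mulr_sumr sum_fund_kernel mulr1.
  under eq_bigr do rewrite ZK eq_sym.
  exact: sum_delta.
have Zcol y : \sum_z Z z y = 1.
  transitivity (\sum_z \sum_w fund_kernel z w * Z w y).
    rewrite exchange_big; apply: eq_bigr => w _ /=.
    rewrite -mulr_suml; under eq_bigr do rewrite fund_kernel_sym.
    by rewrite sum_fund_kernel mul1r.
  under eq_bigr do rewrite KZ.
  exact: sum_delta.
have Zdiag y : Z y y <= 4.
  have := fund_kernel_coercive (Z ^~ y).
  have -> : \sum_z \sum_w fund_kernel z w * Z z y * Z w y = Z y y.
    under eq_bigr => z _ do
      (under eq_bigr => w _ do rewrite mulrAC; rewrite -mulr_suml KZ).
    rewrite (bigD1 y) //= eqxx mul1r big1 ?addr0 // => z /negPf->.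
    by rewrite mul0r.
  have : Z y y ^+ 2 <= sqnorm (Z ^~ y).
    by rewrite /sqnorm (bigD1 y) //= lerDl sumr_ge0 // => z _; apply: sqr_ge0.
  nra.
pose H y z := n * (Z y y - Z z y).
have Hstep y z : z != y -> 1 + \sum_w step R G z w * H y w = H y z.
  move=> zy; have := KZ z y; rewrite (negPf zy).
  have -> : \sum_w fund_kernel z w * Z w y =
      Z z y - \sum_w step R G z w * Z w y + n^-1.
    under eq_bigr do rewrite /fund_kernel mulrDl mulrBl.
    rewrite big_split sumrB -mulr_sumr Zcol mulr1 /=; congr (_ - _ + _).
    rewrite (bigD1 z) //= eqxx mul1r big1 ?addr0 // => w wz.
    by rewrite eq_sym (negPf wz) mul0r.
  have -> : \sum_w step R G z w * H y w =
      n * (Z y y - \sum_w step R G z w * Z w y).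
    rewrite -[X in X - _]mul1r -(sum_step R (deg0 z)) mulr_suml -sumrB.
    by rewrite mulr_sumr; apply: eq_bigr => w _; rewrite /H; ring.
  rewrite /H /= => firstE.
  have -> : Z z y = \sum_w step R G z w * Z w y - n^-1 by lra.
  by field; rewrite gt_eqF.
have H0 y z : 0 <= H y z.
  apply: (supersolution_ge0 deg0 (y := y)) => [|w wy].
    by rewrite /H subrr mulr0.
  by rewrite Hstep.
have hit y z : (hitting_time R G z y <= (H y z)%:E)%E.
  by apply: hitting_time_le => // w wy; rewrite Hstep.
have weight y : (deg G y)%:R / (2 * #|edges G|)%:R <= n^-1 :> R.
  have E : (#|V| * d <= 2 * #|edges G|)%N.
    apply: leq_trans (sum_deg_le G).
    by rewrite (eq_bigr (fun=> d)) ?sum_nat_const.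
  have dn : 0 < (#|V| * d)%:R :> R by rewrite natrM mulr_gt0 // ltr0n.
  rewrite Gd ler_pdivrMr; last by apply: lt_le_trans dn _; rewrite ler_nat.
  by rewrite ler_pdivlMl // -natrM ler_nat.
rewrite /kemeny_from.
apply: (@le_trans _ _ (\sum_(y | y != x) (n^-1 * H y x)%:E)%E).
  apply: lee_sum => y _; rewrite EFinM.
  apply: le_trans (lee_wpmul2l _ (hit y x)) _.
    by rewrite lee_fin divr_ge0.
  by rewrite -!EFinM lee_fin ler_wpM2r.
rewrite sumEFin lee_fin.
have -> : \sum_(y | y != x) n^-1 * H y x = \sum_y (Z y y - Z x y).
  rewrite [RHS](bigD1 x) //= subrr add0r; apply: eq_bigr => y _.
  by rewrite /H mulKf // gt_eqF.
rewrite sumrB Zrow lerBlDr; apply: ler_wpDr => //.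
apply: le_trans (ler_sum _ (fun y _ => Zdiag y)) _.
by rewrite sumr_const -[_ *+ #|_|]mulr_natl.
Qed.

End GapKemeny.

Lemma kemeny_small (R : realType) (V : finType) (G : sgraph V) :
  (#|V| <= 1)%N -> (kemeny R G <= 0)%E.
Proof.
move=> /fintype_le1P V1; rewrite /kemeny.
have -> : connected_graph G.
  by apply/forallP => x; apply/forallP => y; rewrite (V1 x y) connect0.
case: pickP => // x _; rewrite /kemeny_from big_pred0 // => y.
by rewrite (V1 y x) eqxx.
Qed.

Theorem corollary3p4 (R : realType) :
  exists Psi : R, forall (n : nat) (G : sgraph 'I_n), regular G ->
    (Order.min (kemeny R G) (kemeny R (compl G)) <= (n%:R * Psi)%:E)%E.
Proof.
exists 4 => n G [d Gd].
have [n1|n1] := leqP n 1.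
  apply: (@le_trans _ _ 0%E); last by rewrite lee_fin mulr_ge0.
  by rewrite ge_min kemeny_small ?card_ord.
have Cd x : deg (compl G) x = (n - d.+1)%N.
  have := deg_compl G x; rewrite Gd card_ord -addnS => nE.
  by rewrite -[X in (X - _)%N]nE addnK.
(* With more than one vertex, an edgeless graph satisfies its gap inequality
   0 <= 0 without being connected. The other graph is then complete, and its
   nontrivial eigenvalues are all -1. *)
have [d0|d0] := posnP d.
  have e0 : (0 < n - d.+1)%N by rewrite d0 subn_gt0.
  have := gap_kemeny Cd e0; rewrite card_ord ge_min => -> //.
    by rewrite orbT.
  move=> f f0; rewrite adj_form_compl //.
  rewrite (adj_form_deg0 _ (fun x => etrans (Gd x) d0)) subr0.
  rewrite (@le_trans _ _ 0) ?oppr_le0 ?sqnorm_ge0 //.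
  by rewrite mulr_ge0 ?sqnorm_ge0 // mulr_ge0.
have [e0|e0] := posnP (n - d.+1).
  have := gap_kemeny Gd d0; rewrite card_ord ge_min => -> // f f0.
  have := adj_form_compl G f0.
  rewrite (adj_form_deg0 _ (fun x => etrans (Cd x) e0)) => Qf.
  have : 0 <= 3 / 4 * d%:R * sqnorm f.
    by rewrite mulr_ge0 ?sqnorm_ge0 // mulr_ge0.
  by have := sqnorm_ge0 f; lra.
rewrite ge_min; have [Ggap|Cgap] := gap_or_gap_compl R Gd d0.
  by have := gap_kemeny Gd d0 Ggap; rewrite card_ord => ->.
rewrite card_ord in Cgap.
by have := gap_kemeny Cd e0 Cgap; rewrite card_ord => ->; rewrite orbT.
Qed.
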